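(* Let $L>0$, let $f\in\mathcal{F}^{1,1}_L$ have a minimizer $x^\star\in\mathbb{R}^n$, and put $f^\star=f(x^\star)$. Let $a\in(0,1/L]$ and, for $k\in\mathbb{N}_0$, set $$\beta_k=\frac{k}{k+2},\qquad \alpha_k=\frac{a}{k+2}.$$ Let $x_0\in\mathbb{R}^n$, $x_{-1}=x_0$, and let $\{x_k\}$ be generated by the Heavy-ball iteration with time-varying step-sizes $$x_{k+1}=x_k-\alpha_k\nabla f(x_k)+\beta_k(x_k-x_{k-1}),\qquad k\in\mathbb{N}_0 .$$ Then $$f(x_T)-f^\star\le\frac{\|x_0-x^\star\|^2}{2a\,(T+1)},\qquad T\in\mathbb{N}.$$
   Context: $\|\cdot\|$ is the Euclidean norm on $\mathbb{R}^n$, $\mathbb{N}=\{1,2,\dots\}$ and $\mathbb{N}_0=\{0,1,2,\dots\}$. A function $f:\mathbb{R}^n\to\mathbb{R}$ belongs to the class $\mathcal{F}^{1,1}_L$ if it is convex, continuously differentiable, and its gradient is Lipschitz continuous with constant $L$, i.e. $0\le f(y)-f(x)-\langle\nabla f(x),y-x\rangle\le\frac{L}{2}\|x-y\|^2$ for all $x,y\in\mathbb{R}^n$. *)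

(* Defs.v *)
From mathcomp Require Import all_boot all_order all_algebra.
From mathcomp Require Import all_classical all_reals all_analysis.
Import Order.TTheory GRing.Theory Num.Theory.
Import numFieldNormedType.Exports.

Set Implicit Arguments.
Unset Strict Implicit.
Unset Printing Implicit Defensive.

Local Open Scope classical_set_scope.
Local Open Scope ring_scope.

(* The library norm `|u| on 'rV[R]_n is the sup norm.  It induces the same
   topology, hence the same differentiability and continuity, as the Euclidean
   norm, but the Lipschitz constant and the rate have to be measured in the
   latter. *)
Definition enorm (R : realType) (n : nat) (u : 'rV[R]_n) : R :=
  Num.sqrt (\sum_(i < n) u ord0 i ^+ 2).

Definition gradient (R : realType) (n : nat) (f : 'rV[R]_n -> R)
    (x : 'rV[R]_n) : 'rV[R]_n :=
  \row_(i < n) 'D_(delta_mx ord0 i) f x.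

(* Given the other fields, the Lipschitz condition is equivalent to
   0 <= f y - f x - <gradient f x, y - x> <= L / 2 * enorm (x - y) ^+ 2. *)
Record F11 (R : realType) (n : nat) (L : R) (f : 'rV[R]_n -> R) : Prop := {
  F11_convex : convex_function [set: 'rV[R]_n] f;
  F11_differentiable : forall x, differentiable f x;
  F11_gradient_continuous : continuous (gradient f);
  F11_gradient_lipschitz : forall x y,
    enorm (gradient f x - gradient f y) <= L * enorm (x - y)
}.

(* Trajectories are indexed by int so that x (-1) exists; the values at
   indices below -1 are irrelevant. *)
Definition heavy_ball (R : realType) (n : nat) (f : 'rV[R]_n -> R)
    (alpha beta : nat -> R) (x : int -> 'rV[R]_n) : Prop :=
  forall k : nat,
    x (k%:Z + 1) = x k%:Z - alpha k *: gradient f (x k%:Z)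
                   + beta k *: (x k%:Z - x (k%:Z - 1)).

(* Main.v *)
(* In the variable z_k = x_k + k (x_k - x_(k-1)) the Heavy-ball iteration is
   the plain gradient step z_(k+1) = z_k - a grad f(x_k).  Expanding
   |z_(k+1) - xstar|^2, and bounding <grad f(x_k), x_k - xstar> below by
   f(x_k) - fstar + |grad f(x_k)|^2 / (2 L) and <grad f(x_k), x_k - x_(k-1)> below
   by f(x_k) - f(x_(k-1)), shows that
   2 a k (f(x_(k-1)) - fstar) + |z_k - xstar|^2 is nonincreasing in k; a <= 1 / L is
   what absorbs the term a^2 |grad f(x_k)|^2. *)
Require Import Defs.
From mathcomp Require Import all_boot all_order all_algebra.
From mathcomp Require Import all_classical all_reals all_analysis.
From mathcomp Require Import ring lra.
Import Order.TTheory GRing.Theory Num.Theory.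
Import numFieldNormedType.Exports.

Set Implicit Arguments.
Unset Strict Implicit.

Local Open Scope ring_scope.

Definition dotp (R : realType) (n : nat) (u v : 'rV[R]_n) : R :=
  \sum_(i < n) u ord0 i * v ord0 i.

Lemma dotpC (R : realType) (n : nat) (u v : 'rV[R]_n) : dotp u v = dotp v u.
Proof. by apply: eq_bigr => i _; rewrite mulrC. Qed.

Lemma dotpDl (R : realType) (n : nat) (u v w : 'rV[R]_n) :
  dotp (u + v) w = dotp u w + dotp v w.
Proof. by rewrite -big_split; apply: eq_bigr => i _; rewrite mxE mulrDl. Qed.

Lemma dotpZl (R : realType) (n : nat) (c : R) (u w : 'rV[R]_n) :
  dotp (c *: u) w = c * dotp u w.
Proof. by rewrite mulr_sumr; apply: eq_bigr => i _; rewrite mxE mulrA. Qed.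

Lemma dotpDr (R : realType) (n : nat) (u v w : 'rV[R]_n) :
  dotp w (u + v) = dotp w u + dotp w v.
Proof. by rewrite dotpC dotpDl !(dotpC w). Qed.

Lemma dotpZr (R : realType) (n : nat) (c : R) (u w : 'rV[R]_n) :
  dotp w (c *: u) = c * dotp w u.
Proof. by rewrite dotpC dotpZl dotpC. Qed.

Lemma dotp_ge0 (R : realType) (n : nat) (u : 'rV[R]_n) : 0 <= dotp u u.
Proof. by apply: sumr_ge0 => i _; rewrite -expr2 sqr_ge0. Qed.

Lemma enorm_sqr (R : realType) (n : nat) (u : 'rV[R]_n) :
  enorm u ^+ 2 = dotp u u.
Proof.
rewrite /enorm sqr_sqrtr; first by apply: eq_bigr => i _; rewrite expr2.
by apply: sumr_ge0 => i _; apply: sqr_ge0.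
Qed.

Lemma enorm_sqrBZ (R : realType) (n : nat) (c : R) (u v : 'rV[R]_n) :
  enorm (u - c *: v) ^+ 2
  = enorm u ^+ 2 - 2 * c * dotp v u + c ^+ 2 * enorm v ^+ 2.
Proof.
by rewrite !enorm_sqr -scaleNr !(dotpDl, dotpDr, dotpZl, dotpZr) (dotpC u); ring.
Qed.

Lemma enormZ_sqr (R : realType) (n : nat) (c : R) (u : 'rV[R]_n) :
  enorm (c *: u) ^+ 2 = c ^+ 2 * enorm u ^+ 2.
Proof. by rewrite !enorm_sqr dotpZl dotpZr; ring. Qed.

(** The differential is linear, so it can be evaluated on the expansion of [v] in the standard
    basis, where its values are the partial derivatives. *)
Lemma derive_gradient (R : realType) (n : nat) (f : 'rV[R]_n -> R)
    (x v : 'rV[R]_n) :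
  differentiable f x -> 'D_v f x = dotp (gradient f x) v.
Proof.
move=> df; rewrite deriveE // {1}[v]row_sum_delta linear_sum.
apply: eq_bigr => i _; rewrite linearZ /= mxE deriveE //.
by rewrite mulrC.
Qed.

Lemma is_derive_line (R : realType) (n : nat) (f : 'rV[R]_n -> R)
    (x v : 'rV[R]_n) (t : R) :
  differentiable f (t *: v + x) ->
  is_derive t 1 (fun s : R => f (s *: v + x))
    (dotp (gradient f (t *: v + x)) v).
Proof.
move=> df.
(* The difference quotient of the restriction to the line at [t] is that of [f] at [t *: v + x] in
   direction [v]. *)
have E : (fun h : R => h^-1 *: (((fun s : R => f (s *: v + x)) \o shift t)
            (h *: (1 : R)) - f (t *: v + x)))
       = (fun h : R => h^-1 *: ((f \o shift (t *: v + x)) (h *: v)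
            - f (t *: v + x))).
  apply/funext => h /=; congr (_ *: (f _ - _)).
  by rewrite scalerDl addrA [h *: 1]mulr1.
apply: DeriveDef.
  by rewrite /derivable E; exact: diff_derivable.
by rewrite -derive_gradient // /derive E.
Qed.

Section F11_theory.
Variables (R : realType) (n : nat) (L : R) (f : 'rV[R]_n -> R).
Hypothesis fF11 : F11 L f.
Let fD := F11_differentiable fF11.

Lemma F11_segment_le (x y : 'rV[R]_n) (t : R) : 0 <= t -> t <= 1 ->
  f (t *: (y - x) + x) <= t * f y + (1 - t) * f x.
Proof.
move=> t0 t1.
have -> : t *: (y - x) + x = t *: y + (1 - t) *: x.
  by rewrite scalerBr scalerBl scale1r -addrA [x - _]addrC.
exact: (@F11_convex _ _ _ _ fF11 (Itv01 t0 t1) y x (in_setT _) (in_setT _)).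
Qed.

(** For [0 < h <= 1] convexity bounds the difference quotient of [f] at [x] along [y - x] by
    [f y - f x]; let [h] tend to 0 from the right. *)
Lemma F11_gradient_le (x y : 'rV[R]_n) :
  f x + dotp (gradient f x) (y - x) <= f y.
Proof.
rewrite -lerBrDl -derive_gradient //.
have cv := @diff_derivable _ _ _ _ _ (y - x) (fD x).
rewrite /derive cvg_at_rightE //.
apply: limr_le; first exact/cvgP/cvg_dnbhs_at_right/cv.
near=> h.
have h0 : 0 < h by near: h; exact: nbhs_right_gt.
rewrite /= [_ *: _]mulrC ler_pdivrMr //.
have h1 : h <= 1 by near: h; exact: nbhs_right_le.
have := F11_segment_le x y (ltW h0) h1.
lra.
Unshelve. all: by end_near. Qed.

(** Subtracting [c * t + K * t ^+ 2] from [f (t *: v + x)] gives a function [g] whose derivative on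
    (0, 1) is nonpositive by the Lipschitz bound. The mean value theorem then yields [g 1 <= g 0],
    which is the claim. *)
Lemma F11_descent (x v : 'rV[R]_n) : 0 < L ->
  f (v + x) <= f x + dotp (gradient f x) v + L / 2 * enorm v ^+ 2.
Proof.
move=> L0.
set c := dotp (gradient f x) v; set K := L / 2 * enorm v ^+ 2.
pose g : R -> R := (fun t : R => f (t *: v + x)) - c *: id - K *: (id * id).
have gD (t : R) : is_derive t 1 g
    (dotp (gradient f (t *: v + x)) v - c - L * t * enorm v ^+ 2).
  have fline := is_derive_line (fD (t *: v + x)).
  apply: is_derive_eq; rewrite /K /GRing.scale /=; lra.
have [|t] := @MVT R g _ 0 1 ltr01 (fun t _ => gD t).
  by apply: derivable_within_continuous => t _; have [] := gD t.
rewrite in_itv => /andP[/= t0 _]; rewrite subr0 mulr1.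
rewrite /g !fctE scale0r add0r scale1r /GRing.scale /=.
set G := gradient f (t *: v + x) => gE.
suff : dotp G v - c <= L * t * enorm v ^+ 2 by lra.
have lip : enorm (G - gradient f x) ^+ 2 <= (L * t) ^+ 2 * enorm v ^+ 2.
  have := F11_gradient_lipschitz fF11 (t *: v + x) x.
  rewrite addrK -/G => H.
  rewrite exprMn -mulrA -enormZ_sqr -exprMn lerXn2r // nnegrE ?sqrtr_ge0 //.
  by rewrite mulr_ge0 ?sqrtr_ge0 // ltW.
have Lt0 : 0 < L * t by rewrite mulr_gt0.
(* AM-GM for the gradient increment and L t v, in place of Cauchy-Schwarz. *)
have := sqr_ge0 (enorm (G - gradient f x - (L * t) *: v)).
rewrite enorm_sqrBZ (_ : dotp v _ = dotp G v - c); last first.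
  by rewrite dotpC -scaleN1r dotpDl dotpZl mulN1r.
move=> H; rewrite -(ler_pM2l Lt0); lra.
Qed.

(* Compares the supporting hyperplane at x with the descent bound at xstar, both
   evaluated at the point xstar + L^-1 grad f x. *)
Lemma F11_gradient_min (xstar x : 'rV[R]_n) : 0 < L ->
  (forall y, f xstar <= f y) ->
  f x - f xstar + (2 * L)^-1 * enorm (gradient f x) ^+ 2
  <= dotp (gradient f x) (x - xstar).
Proof.
move=> L0 xmin; set G := gradient f x.
have H1 := F11_gradient_le x (L^-1 *: G + xstar).
have H2 := F11_descent xstar (L^-1 *: G) L0.
(* Fermat's rule at [s = 0], an interior minimum of [f] along the line through [xstar] with
   direction [u]. *)
have Z : dotp (gradient f xstar) (L^-1 *: G) = 0.
  set u := L^-1 *: G.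
  have D (t : R) := is_derive_line (fD (t *: u + xstar)).
  have [| | |t _|_ D0] :=
    @derive1_at_min R (fun s => f (s *: u + xstar)) (-1) 1 0.
  - lra.
  - by move=> t _; have [] := D t.
  - by rewrite in_itv /=; lra.
  - by rewrite scale0r add0r; exact: xmin.
  - by have [_] := D 0; rewrite D0 scale0r add0r.
rewrite Z enormZ_sqr in H2.
have E : dotp G (L^-1 *: G + xstar - x)
   = L^-1 * enorm G ^+ 2 - dotp G (x - xstar).
  have -> : L^-1 *: G + xstar - x = L^-1 *: G + (-1) *: (x - xstar).
    by rewrite scaleN1r opprB addrA.
  by rewrite enorm_sqr (dotpDr (L^-1 *: G)) !dotpZr mulN1r.
rewrite -/G E in H1.
have LL : L / 2 * (L^-1 ^+ 2 * enorm G ^+ 2) = (2 * L)^-1 * enorm G ^+ 2.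
  by field; rewrite gt_eqF.
have LM : L^-1 = 2 * (2 * L)^-1 by field; rewrite gt_eqF.
rewrite LL in H2; rewrite LM in H1 H2.
lra.
Qed.
End F11_theory.

Theorem theorem2 (R : realType) (n : nat) (L : R) (L_gt0 : 0 < L)
    (f : 'rV[R]_n -> R) (fF11 : F11 L f)
    (xstar : 'rV[R]_n) (xstar_min : forall y, f xstar <= f y)
    (a : R) (a_gt0 : 0 < a) (a_le : a <= 1 / L)
    (x0 : 'rV[R]_n) (x : int -> 'rV[R]_n)
    (x_0 : x 0 = x0) (x_m1 : x (- 1) = x0)
    (x_hb : heavy_ball f (fun k => a / (k%:R + 2)) (fun k => k%:R / (k%:R + 2)) x)
    (T : nat) (T_gt0 : (0 < T)%N) :
  f (x T%:Z) - f xstar <= enorm (x0 - xstar) ^+ 2 / (2 * a * (T%:R + 1)).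
Proof.
pose z (k : nat) := x k%:Z + k%:R *: (x k%:Z - x (k%:Z - 1)).
have x_pred (k : nat) : x (k.+1%:Z - 1) = x k%:Z by rewrite intS addrAC subrr add0r.
(* With d = x_(k+1) - x_k, z_(k+1) = x_k + (k + 2) d, and the factor k + 2 cancels the denominators
   of both step-sizes. *)
have z_rec (k : nat) : z k.+1 = z k - a *: gradient f (x k%:Z).
  rewrite /z x_pred intS [1 + _]addrC x_hb.
  apply/rowP => i; rewrite !mxE -natr1.
  have : k%:R + 2 != 0 :> R by rewrite -natrD pnatr_eq0 addn2.
  by move=> ?; field.
have energy (k : nat) :
    2 * a * k%:R * (f (x (k%:Z - 1)) - f xstar) + enorm (z k - xstar) ^+ 2
    <= enorm (x0 - xstar) ^+ 2.
  elim: k => [|k IHk].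
    by rewrite /z x_0 scale0r addr0 mulr0 mul0r add0r.
  apply: le_trans IHk; rewrite z_rec x_pred addrAC enorm_sqrBZ.
  set G := gradient f (x k%:Z).
  have Gmin := F11_gradient_min fF11 (x k%:Z) L_gt0 xstar_min.
  have Gpred := F11_gradient_le fF11 (x k%:Z) (x (k%:Z - 1)).
  rewrite -/G in Gmin Gpred.
  (* The momentum part is written with x_(k-1) - x_k to match the supporting hyperplane at x_k,
     evaluated at x_(k-1). *)
  have -> : dotp G (z k - xstar) = dotp G (x k%:Z - xstar)
      - k%:R * dotp G (x (k%:Z - 1) - x k%:Z).
    by rewrite -mulNr -dotpZr -dotpDr /z; congr dotp;
      rewrite scaleNr -scalerN opprB addrAC.
  (* Both gradient inequalities are scaled by their weights, 2 a k and 2 a, so that only a linear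
     combination remains. *)
  have {}Gpred : 2 * a * k%:R
      * (f (x k%:Z) + dotp G (x (k%:Z - 1) - x k%:Z) - f (x (k%:Z - 1))) <= 0.
    apply: mulr_ge0_le0; last by lra.
    by rewrite !mulr_ge0 // ltW.
  have {}Gmin := ler_wpM2l (ltW (mulr_gt0 (ltr0Sn _ 1) a_gt0)) Gmin.
  have aG : a ^+ 2 * enorm G ^+ 2 <= 2 * a * ((2 * L)^-1 * enorm G ^+ 2).
    rewrite [leRHS]mulrA ler_wpM2r ?sqr_ge0 // (_ : 2 * a / (2 * L) = a * (1 / L)).
      by rewrite expr2 ler_pM2l.
    by field; rewrite gt_eqF.
  rewrite -natr1; lra.
(* The energy at index k controls f(x_(k-1)), so index T + 1 gives x_T with the weight 2 a (T +
   1). *)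
have := energy T.+1; rewrite x_pred -natr1 => H.
have := sqr_ge0 (enorm (z T.+1 - xstar)).
have T1 : 0 < T%:R + 1 :> R by rewrite natr1 ltr0Sn.
rewrite ler_pdivlMr ?mulr_gt0 // => H'.
lra.
Qed.
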